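(* Let $n\ge2$, let the group $\mathcal{F}_n=\bigcup_{k\ge1}F(k)$, $F(k)\cong\operatorname{Sym}(n^k)$, act on $\mathbb{T}$ by base $n$ prefix-permutation, and let $Y\subset\mathbb{T}$ be an infinite set. Then for every $\varepsilon>0$, $$\mathcal{Z}_k(Y,\varepsilon)=\frac{1}{n^k!}\Big|\{g\in \operatorname{Sym}(n^k): d_H(g(Y),\mathbb{T})<\varepsilon\}\Big|\to 1\quad\text{as }k\to\infty.$$
   Context: $\mathbb{T}=\mathbb{R}/\mathbb{Z}$ with its usual metric; for $A\subset\mathbb{T}$, $d_H(A,\mathbb{T})=\sup_{x\in\mathbb{T}}d(x,A)$. For $k\ge1$, $\operatorname{Sym}(n^k)$ is identified with the group of permutations of the set $\{0,\dots,n-1\}^k$ of words of length $k$. For a word $w=w_1\cdots w_k$ let $e(w)=\sum_{j=1}^k w_jn^{-j}$ and $I_w=[e(w),e(w)+n^{-k})\subset\mathbb{T}$. Base $n$ prefix-permutation: $\tau\in\operatorname{Sym}(n^k)$ acts on $\mathbb{T}$ by mapping each $I_w$ onto $I_{\tau(w)}$ by translation, i.e. $\tau(x)=x-e(w)+e(\tau(w))$ for $x\in I_w$ (equivalently, $\tau$ permutes the first $k$ base-$n$ digits of $x$, using the expansion not ending in repeated digits $n-1$, and leaves the remaining digits unchanged). These actions are compatible under the inclusions $F(k)\subset F(k+1)$ (acting on the first $k$ letters). *)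

(* Defs.v *)
From HB Require Import structures.
From mathcomp Require Import all_boot all_order all_algebra all_fingroup.
From mathcomp Require Import generic_quotient ring_quotient.
From mathcomp Require Import lra.
From mathcomp Require Import all_classical all_reals all_analysis.

Set Implicit Arguments.
Unset Strict Implicit.
Unset Printing Implicit Defensive.

Import Order.TTheory GRing.Theory Num.Theory.
Import numFieldNormedType.Exports.

Local Open Scope classical_set_scope.
Local Open Scope ring_scope.

(* The quotient group R / Z.  [Num.int_num_subdef] is the predicate underlying
   the qualifier [Num.int]; it is the one that carries the [zmodClosed]
   instance required by [Quotient.quot]. *)
Definition circle (R : realType) : Type :=
  Quotient.quot (Num.int_num_subdef : {pred R}).

HB.instance Definition _ (R : realType) := GRing.Zmodule.on (circle R).

Definition toT (R : realType) (x : R) : circle R :=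
  \pi_(Quotient.quot (Num.int_num_subdef : {pred R}))%qT x.

Section Metric.
Variable R : realType.
Implicit Types (x y : circle R) (A : set (circle R)).

(* The quotient metric: the least absolute value of a real representing the
   difference x - y. *)
Definition dist_circle x y : R := inf [set `|t| | t in [set t | toT t = x - y]].

Definition dist_set x A : R := inf [set dist_circle x a | a in A].

(* d_H(A, R / Z) for nonempty A: inf and sup are real-valued here, and are the
   actual infimum and supremum because every set involved is then nonempty and
   bounded on the relevant side (dist_circle takes values in [0, 1/2]). *)
Definition dH A : R := sup [set dist_set x A | x in [set: circle R]].

End Metric.

Section PrefixPermutation.
Variables (R : realType) (n k : nat).

(* Positions are numbered from 0: tnth w j is the letter w_(j+1). *)
Definition word_val (w : k.-tuple 'I_n) : R :=
  \sum_(j < k) (tnth w j)%:R * n%:R ^- j.+1.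

Definition word_arc (w : k.-tuple 'I_n) : set (circle R) :=
  [set toT t | t in [set t | word_val w <= t < word_val w + n%:R ^- k]].

(* For 0 < n the arcs partition the circle (see prefix_actE below), so that
   exactly one word is picked and the default branch is never used. *)
Definition prefix_act (tau : {perm k.-tuple 'I_n}) (x : circle R) : circle R :=
  if [pick w | `[< word_arc w x >]] is Some w
  then x - toT (word_val w) + toT (word_val (tau w))
  else x.

Definition Zk (Y : set (circle R)) (eps : R) : R :=
  #|[pred g : {perm k.-tuple 'I_n} | `[< dH (prefix_act g @` Y) < eps >]]|%:R
  / ((n ^ k)`!)%:R.

End PrefixPermutation.
Arguments Zk {R} n k Y eps.

Section Facts.
Variable R : realType.

Lemma toT_is_zmod_morphism : zmod_morphism (@toT R).
Proof. by move=> x y; rewrite /toT !piE. Qed.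

HB.instance Definition _ :=
  GRing.isZmodMorphism.Build R (circle R) (@toT R) toT_is_zmod_morphism.

Lemma toT_eq (x y : R) : toT x = toT y <-> x - y \is a Num.int.
Proof.
rewrite (_ : (x - y \is a Num.int) = (x - y \in (Num.int_num_subdef : {pred R}))) //.
rewrite Quotient.idealrBE; split=> [xy|/eqP//]; exact/eqP.
Qed.

Lemma toT_surj (x : circle R) : exists2 t, 0 <= t < 1 & toT t = x.
Proof.
pose t : R := repr (x : Quotient.quot (Num.int_num_subdef : {pred R})).
have tx : toT t = x by rewrite /toT reprK.
exists (t - (Num.floor t)%:~R).
  by rewrite subr_ge0 floor_le ltrBlDl -intrD1 floorD1_gt.
by rewrite -[RHS]tx; apply/toT_eq; rewrite addrAC subrr add0r rpredN intr_int.
Qed.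

Variables (n k : nat).
Hypothesis n_gt0 : (0 < n)%N.

Let value (s : seq 'I_n) : nat := foldl (fun a (d : 'I_n) => a * n + d)%N 0%N s.

Let value_lt s : (value s < n ^ size s)%N.
Proof.
elim/last_ind: s => [|s d IHs]; first by rewrite expn0.
rewrite /value foldl_rcons -/(value s) size_rcons expnSr.
apply: (@leq_trans ((value s).+1 * n)%N); last by rewrite leq_mul2r IHs orbT.
by rewrite mulSn addnC ltn_add2r.
Qed.

Let value_inj s1 s2 : size s1 = size s2 -> value s1 = value s2 -> s1 = s2.
Proof.
elim/last_ind: s1 s2 => [|s1 d1 IHs] s2; first by case: s2.
case/lastP: s2 => [|s2 d2]; first by rewrite size_rcons.
rewrite /value !foldl_rcons -!/(value _) !size_rcons => -[ssz] E.
have dE : d1 = d2.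
  by apply/val_inj; move/(congr1 (modn^~ n)): E; rewrite !modnMDl !modn_small.
have sE : value s1 = value s2.
  by apply/eqP; move/eqP: E; rewrite dE eqn_add2r eqn_pmul2r.
by rewrite dE (IHs _ ssz sE).
Qed.

Let word_valE (w : k.-tuple 'I_n) : word_val R w = (value w)%:R * n%:R ^- k.
Proof.
have n0 : (n%:R : R) != 0 by rewrite pnatr_eq0 -lt0n.
pose d0 : 'I_n := Ordinal n_gt0.
have E (s : seq 'I_n) :
  \sum_(j < size s) (nth d0 s j)%:R * n%:R ^- j.+1
    = (value s)%:R * n%:R ^- size s :> R.
  elim/last_ind: s => [|s d IHs]; first by rewrite big_ord0 mul0r.
  rewrite /value foldl_rcons -/(value s) size_rcons big_ord_recr /=.
  rewrite nth_rcons ltnn eqxx natrD mulrDl; congr (_ + _).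
  rewrite natrM exprS invfM mulrA mulfK // -IHs.
  by apply: eq_bigr => j _; rewrite nth_rcons ltn_ord.
rewrite /word_val -[X in _ ^- X](size_tuple w) -E size_tuple.
by apply: eq_bigr => j _; rewrite (tnth_nth d0).
Qed.

Lemma word_val_bound (w : k.-tuple 'I_n) :
  0 <= word_val R w /\ word_val R w + n%:R ^- k <= 1.
Proof.
have p0 : (0 : R) < n%:R ^+ k by rewrite exprn_gt0 ?ltr0n.
rewrite word_valE; split; first by rewrite mulr_ge0 ?ler0n // invr_ge0 ltW.
rewrite -[X in _ + X]mul1r -mulrDl ler_pdivrMr // mul1r natr1 -natrX ler_nat.
by rewrite -[X in (_ <= _ ^ X)%N](size_tuple w) value_lt.
Qed.

Lemma word_arc_exists (x : circle R) : exists w : k.-tuple 'I_n, word_arc w x.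
Proof.
have [t /andP[t0 t1] <-] := toT_surj x.
have p0 : (0 : R) < n%:R ^+ k by rewrite exprn_gt0 ?ltr0n.
have vlt (w : k.-tuple 'I_n) : (value w < n ^ k)%N.
  by rewrite -[X in (_ ^ X)%N](size_tuple w) value_lt.
pose f (w : k.-tuple 'I_n) : 'I_(n ^ k) := Ordinal (vlt w).
have f_inj : injective f.
  by move=> u v [/value_inj uv]; apply/val_inj/uv; rewrite !size_tuple.
have f_bij : bijective f.
  by apply: inj_card_bij => //; rewrite card_tuple !card_ord.
have tp0 : 0 <= t * n%:R ^+ k by rewrite mulr_ge0 // ltW.
have mlt : (Num.truncn (t * n%:R ^+ k) < n ^ k)%N.
  rewrite -(ltr_nat R) natrX (@le_lt_trans _ _ (t * n%:R ^+ k)) ?truncn_le //.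
  by rewrite gtr_pMl.
have [g _ fg] := f_bij; exists (g (Ordinal mlt)); exists t => //=.
have /(congr1 val)/= := fg (Ordinal mlt); rewrite word_valE => ->.
rewrite -[X in _ + X]mul1r -mulrDl ler_pdivrMr // ltr_pdivlMr // natr1.
exact: truncn_itv.
Qed.

Lemma word_arc_inj (u v : k.-tuple 'I_n) (x : circle R) :
  word_arc u x -> word_arc v x -> u = v.
Proof.
have p0 : (0 : R) < n%:R ^+ k by rewrite exprn_gt0 ?ltr0n.
case=> s /= /andP[us su] sx [t /= /andP[vt tv] tx].
have [u0 u1] := word_val_bound u; have [v0 v1] := word_val_bound v.
have st : s = t.
  have /toT_eq/intrP[m mE] : toT s = toT t by rewrite sx tx.
  have m0 : `|m%:~R| < 1 :> R.
    have := lt_le_trans su u1; have := lt_le_trans tv v1.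
    have := le_trans u0 us; have := le_trans v0 vt.
    rewrite -mE ltr_norml; lra.
  rewrite -intr_norm -[X in _ < X](mulr1z 1) ltr_int in m0.
  have {}m0 : m = 0 by apply/eqP; rewrite -normr_le0 -ltzD1.
  by apply/eqP; rewrite -subr_eq0 mE m0.
rewrite {}st {s sx u0 u1 v0 v1} in us su.
move: us su vt tv; rewrite !word_valE.
have E (a : R) : a * n%:R ^- k + n%:R ^- k = (a + 1) * n%:R ^- k.
  by rewrite mulrDl mul1r.
rewrite !E => us su vt tv.
apply/val_inj/value_inj; first by rewrite !size_tuple.
have := le_lt_trans us tv; have := le_lt_trans vt su.
rewrite !ltr_pM2r ?invr_gt0 // !natr1 !ltr_nat !ltnS => vu uv.
by apply/eqP; rewrite eqn_leq uv.
Qed.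

Lemma prefix_actE (tau : {perm k.-tuple 'I_n}) w (x : circle R) :
  word_arc w x ->
  prefix_act tau x = x - toT (word_val R w) + toT (word_val R (tau w)).
Proof.
move=> wx; rewrite /prefix_act; case: pickP => [v /asboolP vx|/(_ w)].
  by rewrite (word_arc_inj vx wx).
by move/asboolP.
Qed.

End Facts.

(* Main.v *)
Require Import Defs.
From HB Require Import structures.
From mathcomp Require Import all_boot all_order all_algebra all_fingroup.
From mathcomp Require Import all_classical all_reals all_analysis.
From mathcomp Require Import finmap lra.

Import Order.TTheory GRing.Theory Num.Theory.
Import numFieldNormedType.Exports.

(** Fix a length [l] with [n ^- l < eps].  The arcs [I_u], [u] a word of length
    [l], cover the circle and have diameter at most [n ^- l], so a set that meets
    all of them is [eps]-dense ([dH_le_word_arcs]).  It is therefore enough to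
    show that, for a random [g], the set [g Y] meets all [n ^ l] of these arcs
    with probability tending to 1.

    Since [Y] is infinite, for every [m] the points of [Y] occupy at least [m]
    different arcs of length [k] as soon as [k] is large
    ([infinite_set_meets_many_arcs]): finitely many distinct points end up in
    distinct arcs once [n ^- k] is smaller than their mutual distances.  Let [S]
    be the set of words of these arcs.  The images of the words of [S] under a
    uniform permutation are drawn without replacement from the [n ^ k] words, and
    the words beginning with a given [u] form a proportion [n ^- l] of them;
    drawing without replacement only makes it harder to avoid these words, so all
    of [S] misses [I_u] with probability at most [(1 - n ^- l) ^ m]
    ([card_perm_maps_to]).  The union bound over [u] ([card_perm_misses]) gives
    the quantitative estimate [Zk_ge],
      [1 - n ^ l * (1 - n ^- l) ^ m <= Zk n k Y eps],
    for all large [k].  With [l] fixed, the left-hand side is as close to 1 as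
    desired when [m] is large. *)

(** * Counting permutations by the image of a subset *)

Section RandomPermutation.
Local Open Scope nat_scope.
Context {T : finType}.
Implicit Types (S C : {set T}).

Lemma card_perm_type : #|{perm T}| = (#|T|)`!.
Proof.
rewrite -[in RHS]cardsT -[RHS]card_perm -[LHS]cardsT; apply: eq_card => g.
by rewrite inE [RHS]unfold_in; apply/esym/fintype.subsetP => x; rewrite inE.
Qed.

(** Conditionally on [g] mapping [S] into [C], the value of [g] at a new point
    [x] is uniform among the [#|T| - #|S|] values left, of which [#|C| - #|S|]
    lie in [C]; and [(#|C| - #|S|) / (#|T| - #|S|) <= #|C| / #|T|].  The
    conditional uniformity is obtained by double counting the pairs [(g, z)] with
    [z] outside [S] and [g] mapping [z |: S] into [C]. *)
Lemma card_perm_maps_to_setU1 S C (x : T) :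
  x \notin S ->
  #|[set g : {perm T} | x |: S \subset g @^-1: C]| * #|T|
    <= #|[set g : {perm T} | S \subset g @^-1: C]| * #|C|.
Proof.
move=> xS.
set F := fun A : {set T} => #|[set g : {perm T} | A \subset g @^-1: C]|.
(* Precomposition with the transposition of x and z exchanges the two sets. *)
have Fsym z : z \notin S -> F (z |: S) = F (x |: S).
  move=> zS; rewrite /F -(card_imset _ (@mulgI _ (tperm x z))).
  congr #|pred_of_set _|; apply/setP=> g.
  have gE (h : {perm T}) : h \in [set tperm x z * g0 | g0 in
      [set g : {perm T} | z |: S \subset g @^-1: C]]%g
      = (z |: S \subset (tperm x z * h)%g @^-1: C).
    rewrite -[h in LHS](mulKg (tperm x z)) tpermV mem_imset ?inE //.
    exact: mulgI.
  rewrite gE inE !finset.subUset !finset.sub1set !inE permM tpermR.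
  congr (_ && _).
  apply/fintype.subsetP/fintype.subsetP => h y yS;
    have := h y yS; rewrite !inE permM tpermD //;
    by [apply: contraNneq xS => -> | apply: contraNneq zS => ->].
have count : F (x |: S) * #|~: S| = F S * (#|C| - #|S|).
  rewrite mulnC -sum_nat_const (eq_bigr (fun z => F (z |: S))); last first.
    by move=> z; rewrite inE => /Fsym.
  rewrite /F; under eq_bigr => z _ do
    rewrite -sum1_card (big_mkcond (fun g => g \in _)).
  rewrite exchange_big /= -sum_nat_const [RHS]big_mkcond.
  apply: eq_bigr => g _; rewrite -big_mkcondr inE.
  case: ifP => [SC|/negP SnC].
    rewrite sum1_card -(card_preimset C (@perm_inj _ g)).
    rewrite -[in RHS](finset.setIidPr SC) -cardsD; apply: eq_card => z.
    by rewrite unfold_in !inE finset.subUset SC finset.sub1set inE andbT.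
  apply: big_pred0 => z; rewrite !inE finset.subUset.
  by apply/negP => /andP[_ /andP[_ /SnC]].
have S_lt : 0 < #|~: S| by apply/card_gt0P; exists x; rewrite inE.
rewrite -(leq_pmul2r S_lt) mulnAC count mulnAC -mulnA -[leqRHS]mulnA leq_mul2l.
apply/orP; right.
rewrite [#|~: S|]cardsCs finset.setCK !mulnBr [#|T| * #|C|]mulnC leq_sub2l //.
by rewrite leq_mul2r max_card orbT.
Qed.

(** The image of [S] under a uniform permutation is a sequence of draws without
    replacement, and each draw that stays in [C] makes the next one less likely
    to do so: the bound is the one for draws with replacement. *)
Lemma card_perm_maps_to S C :
  #|[set g : {perm T} | S \subset g @^-1: C]| * #|T| ^ #|S|
    <= #|C| ^ #|S| * (#|T|)`!.
Proof.
move: {-1}#|S| (erefl #|S|) => m; elim: m S => [|m IHm] S cardS.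
  by rewrite !expn0 muln1 mul1n -card_perm_type max_card.
have [x xS] : exists x, x \in S by apply/card_gt0P; rewrite cardS.
have S'card : #|S :\ x| = m by move: cardS; rewrite (cardsD1 x) xS => -[].
have := card_perm_maps_to_setU1 _ C _ (negbT (finset.setD11 x S)).
rewrite finset.setD1K // => step.
rewrite !expnS mulnA (leq_trans (leq_mul step (leqnn _))) //.
by rewrite mulnAC [leqLHS]mulnC -mulnA leq_mul2l IHm ?orbT.
Qed.

(** Union bound over the targets [B u], a target being missed exactly when [S]
    is mapped into its complement. *)
Lemma card_perm_misses (U : finType) S (B : U -> {set T}) b :
  (forall u, b <= #|B u|) ->
  #|[set g : {perm T} | [exists u, S \subset g @^-1: (~: B u)]]| * #|T| ^ #|S|
    <= #|U| * (#|T| - b) ^ #|S| * (#|T|)`!.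
Proof.
move=> B_ge.
set miss := fun u => [set g : {perm T} | S \subset g @^-1: (~: B u)].
have -> : [set g : {perm T} | [exists u, S \subset g @^-1: (~: B u)]]
    = \bigcup_u miss u.
  apply/setP=> g; rewrite inE; apply/existsP/bigcupP => [[u Su]|[u _]].
    by exists u; rewrite ?inE.
  by rewrite inE => Su; exists u.
apply: (@leq_trans ((\sum_u #|miss u|) * #|T| ^ #|S|)).
  rewrite leq_mul2r; apply/orP; right.
  apply: (big_ind2 (fun (A : {set {perm T}}) c => #|A| <= c)) => //.
    by rewrite cards0.
  by move=> A c A' c' Ac A'c'; rewrite (leq_trans (leq_card_setU _ _)) ?leq_add.
rewrite big_distrl -mulnA -sum_nat_const leq_sum // => u _.
apply: leq_trans (card_perm_maps_to _ _) _.
rewrite leq_mul2r; apply/orP; right; case: #|S| => // s.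
by rewrite leq_exp2r // cardsCs finset.setCK leq_sub2l.
Qed.

End RandomPermutation.

Local Open Scope classical_set_scope.
Local Open Scope ring_scope.

(** * The metric of the circle *)

Section Circle.
Context {R : realType}.
Implicit Types (x y : circle R) (A : set (circle R)).

Lemma toT_inj_unit (s t : R) :
  0 <= s < 1 -> 0 <= t < 1 -> toT s = toT t -> s = t.
Proof.
move=> /andP[s0 s1] /andP[t0 t1] /toT_eq/intrP[m mE].
have : `|m%:~R| < 1 :> R by rewrite -mE ltr_norml; lra.
rewrite -intr_norm -[X in _ < X](mulr1z 1) ltr_int => m1.
have m0 : m = 0 by apply/eqP; rewrite -normr_le0 -ltzD1.
by apply/eqP; rewrite -subr_eq0 mE m0.
Qed.

Lemma dist_circle_lbound x y :
  lbound [set `|t| | t in [set t : R | toT t = x - y]] 0.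
Proof. by move=> _ [t _ <-]. Qed.

Lemma dist_circle_ge0 x y : 0 <= dist_circle x y.
Proof.
apply: lb_le_inf; last exact: dist_circle_lbound.
by have [t _ tE] := toT_surj (x - y); exists `|t|, t.
Qed.

Lemma dist_circle_toT (s t : R) : dist_circle (toT s) (toT t) <= `|s - t|.
Proof.
apply: ge_inf; first by exists 0; exact: dist_circle_lbound.
by exists (s - t) => //=; rewrite raddfB.
Qed.

Lemma dist_set_le A x a : A a -> dist_set x A <= dist_circle x a.
Proof.
move=> Aa; apply: ge_inf; last by exists a.
by exists 0 => _ [b _ <-]; exact: dist_circle_ge0.
Qed.

End Circle.

(** * Arcs of words *)

Section Words.
Context {R : realType} {n : nat}.
Context (n_gt0 : (0 < n)%N).

Lemma word_val_cat l j (u : l.-tuple 'I_n) (v : j.-tuple 'I_n) :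
  word_val R (cat_tuple u v) = word_val R u + n%:R ^- l * word_val R v.
Proof.
rewrite /word_val big_split_ord mulr_sumr; congr (_ + _).
  by apply: eq_bigr => i _; rewrite tnth_lshift.
apply: eq_bigr => i _; rewrite tnth_rshift mulrCA; congr (_ * _).
by rewrite -invfM -exprD -addnS.
Qed.

(** This inclusion of arcs is what turns hitting a set of words of length [l + j]
    into hitting an arc of length [l]. *)
Lemma word_arc_cat l j (u : l.-tuple 'I_n) (v : j.-tuple 'I_n) :
  @word_arc R _ _ (cat_tuple u v) `<=` word_arc u.
Proof.
have l0 : (0 : R) < n%:R ^- l by rewrite invr_gt0 exprn_gt0 ?ltr0n.
have [v0 v1] := word_val_bound R n_gt0 v.
move=> _ [t /= /andP[t0 t1] <-]; exists t => //=; move: t0 t1.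
rewrite word_val_cat exprD invfM -[_ + _ + _ * _]addrA -mulrDr => t0 t1.
apply/andP; split; first by apply: le_trans t0; rewrite lerDl mulr_ge0 // ltW.
by apply: lt_le_trans t1 _; rewrite lerD2l ler_piMr // ltW.
Qed.

Lemma word_arc_dist k (w : k.-tuple 'I_n) (x y : circle R) :
  word_arc w x -> word_arc w y -> dist_circle x y <= n%:R ^- k.
Proof.
move=> [s /= /andP[s0 s1] <-] [t /= /andP[t0 t1] <-].
apply: le_trans (dist_circle_toT s t) _.
move: s1 t1; set p := n%:R ^- k => s1 t1.
by rewrite ler_norml; lra.
Qed.

Lemma dH_le_word_arcs l (A : set (circle R)) :
  (forall u : l.-tuple 'I_n, exists2 a, A a & word_arc u a) ->
  dH A <= n%:R ^- l.
Proof.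
move=> Adense; apply: ge_sup; first by exists (dist_set 0 A), 0.
move=> _ [x _ <-]; have [u ux] := word_arc_exists l n_gt0 x.
have [a Aa ua] := Adense u.
exact: le_trans (dist_set_le _ x _ Aa) (word_arc_dist _ _ _ _ ux ua).
Qed.

Lemma prefix_act_word_arc k (g : {perm k.-tuple 'I_n}) w (x : circle R) :
  word_arc w x -> word_arc (g w) (prefix_act g x).
Proof.
move=> wx; rewrite (prefix_actE n_gt0 g wx).
case: wx => t /= /andP[t0 t1] <-.
exists (t - word_val R w + word_val R (g w)); last by rewrite raddfD raddfB.
by move: t0 t1; set p := n%:R ^- k => /= t0 t1; apply/andP; split; lra.
Qed.

End Words.

(** * Infinite sets occupy many arcs *)

Section Separation.
Context {R : realType} {n : nat}.
Context (n_gt1 : (1 < n)%N).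
Let n_gt0 : (0 < n)%N := ltnW n_gt1.

(** Two points of a common arc have representatives in the unit interval at
    distance less than [n ^- k], and these representatives do not depend on
    [k]. *)
Lemma word_arc_separates (x y : circle R) : x <> y ->
  \forall k \near \oo, forall w : k.-tuple 'I_n,
    ~ (word_arc w x /\ word_arc w y).
Proof.
have [s s01 <-] := toT_surj x; have [t t01 <-] := toT_surj y => st.
have st0 : 0 < `|s - t|.
  by rewrite normr_gt0 subr_eq0; apply/eqP => E; apply: st; rewrite E.
have n1 : `|n%:R^-1 : R| < 1.
  by rewrite ger0_norm ?invr_ge0 ?ler0n // invf_lt1 ?ltr1n // ltr0n.
apply: filterS (cvgr0_norm_lt _ (cvg_expr n1) _ st0) => k.
rewrite /= exprVn => klt w [[s' /= /andP[s0 s1] sE] [t' /= /andP[t0 t1] tE]].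
have [w0 w1] := word_val_bound R n_gt0 w.
have s's : s' = s.
  apply: toT_inj_unit => //; apply/andP; split; first exact: le_trans s0.
  exact: lt_le_trans w1.
have t't : t' = t.
  apply: toT_inj_unit => //; apply/andP; split; first exact: le_trans t0.
  exact: lt_le_trans w1.
have := ltr_normlW klt.
move: s1 t1; rewrite {}s's {}t't in s0 t0 *; set p := n%:R ^- k => s1 t1.
by apply/negP; rewrite -leNgt ler_norml; lra.
Qed.

Lemma infinite_set_meets_many_arcs (Y : set (circle R)) m :
  infinite_set Y ->
  \forall k \near \oo, exists2 S : {set k.-tuple 'I_n}, (m <= #|S|)%N &
    forall w, w \in S -> exists2 y, Y y & word_arc w y.
Proof.
move=> /(infinite_set_fset m)[B BY mB].
have sep : \forall k \near \oo, forall x y : B, val x <> val y ->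
    forall w : k.-tuple 'I_n, ~ (word_arc w (val x) /\ word_arc w (val y)).
  apply: filter_forall => x; apply: filter_forall => y.
  have [E|NE] := pselect (val x = val y); first exact: nearW.
  by apply: filterS (word_arc_separates _ _ NE) => k kP _.
apply: filterS sep => k sep.
pose word (x : B) := projT1 (cid (word_arc_exists k n_gt0 (val x))).
have wordP x : word_arc (word x) (val x) by rewrite /word; case: cid.
exists [set word x | x : B]%SET.
  rewrite card_imset -?cardfE // => x y xy.
  apply: val_inj; apply: contrapT => ne.
  by apply: (sep x y ne (word x)); split; [|rewrite xy]; exact: wordP.
move=> _ /imsetP[x _ ->]; exists (val x) => //; apply: BY; exact: valP.
Qed.

End Separation.

(** * The proportion of permutations with dense image *)

Section Density.
Context {R : realType} {n : nat}.
Context (n_gt0 : (0 < n)%N).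

Lemma Zk_le1 k (Y : set (circle R)) (eps : R) : Zk n k Y eps <= 1.
Proof.
rewrite /Zk ler_pdivrMr ?ltr0n ?fact_gt0 // mul1r ler_nat.
by apply: leq_trans (max_card _) _; rewrite card_perm_type card_tuple card_ord.
Qed.

(** The targets of the union bound are, for each [u] of length [l], the [n ^ j]
    words of length [l + j] that begin with [u]. *)
Lemma Zk_ge l j m (Y : set (circle R)) (eps : R)
    (S : {set (l + j).-tuple 'I_n}) :
  n%:R ^- l < eps -> (m <= #|S|)%N ->
  (forall w, w \in S -> exists2 y, Y y & word_arc w y) ->
  1 - n%:R ^+ l * (1 - n%:R ^- l) ^+ m <= Zk n (l + j) Y eps.
Proof.
move=> l_eps m_le S_Y.
have l0 : (0 : R) < n%:R ^+ l by rewrite exprn_gt0 ?ltr0n.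
pose B (u : l.-tuple 'I_n) := [set cat_tuple u v | v : j.-tuple 'I_n]%SET.
have cardB u : (n ^ j <= #|B u|)%N.
  rewrite card_imset ?card_tuple ?card_ord // => v v' /(congr1 val)/= /eqP.
  by rewrite eqseq_cat // eqxx => /eqP/val_inj.
set bad := [set g : {perm (l + j).-tuple 'I_n}
  | [exists u, S \subset g @^-1: (~: B u)%SET]]%SET.
have good g : g \notin bad -> dH (prefix_act g @` Y) < eps.
  rewrite inE negb_exists => /forallP hit; apply: le_lt_trans l_eps.
  apply: dH_le_word_arcs => // u.
  have /subsetPn[w wS] := hit u; rewrite !inE negbK => /imsetP[v _ gw].
  have [y Yy wy] := S_Y w wS; exists (prefix_act g y); first by exists y.
  apply: (word_arc_cat n_gt0 _ _ u v); rewrite -gw.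
  exact: prefix_act_word_arc.
have card_bad :
    #|bad|%:R <= n%:R ^+ l * (1 - n%:R ^- l) ^+ m * (n ^ (l + j))`!%:R :> R.
  have := card_perm_misses _ S B _ cardB; rewrite -/bad !card_tuple !card_ord.
  rewrite -(ler_nat R) !natrM !natrX natrB ?leq_pexp2l ?leq_addl //.
  rewrite !natrX.
  have -> : n%:R ^+ (l + j) - n%:R ^+ j
      = (1 - n%:R ^- l) * n%:R ^+ (l + j) :> R.
    by rewrite mulrBl mul1r exprD mulKf // gt_eqF.
  rewrite exprMn mulrA mulrAC ler_pM2r ?exprn_gt0 ?ltr0n // => /le_trans; apply.
  rewrite ler_pM2r ?ltr0n ?fact_gt0 // ler_pM2l // ler_wiXn2l //.
  by rewrite subr_ge0 invf_le1 // exprn_ege1 // ler1n.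
rewrite /Zk ler_pdivlMr ?ltr0n ?fact_gt0 // mulrBl mul1r.
apply: le_trans (lerB (lexx _) card_bad) _.
rewrite lerBlDr -natrD ler_nat.
have <- : #|{perm (l + j).-tuple 'I_n}| = (n ^ (l + j))`!.
  by rewrite card_perm_type card_tuple card_ord.
rewrite -(cardC bad) addnC leq_add2r; apply: subset_leq_card.
apply/fintype.subsetP => g; rewrite inE /= => g_bad.
by rewrite inE; apply/asboolP/good.
Qed.

End Density.

Theorem theorem8p8 (R : realType) (n : nat) (hn : (2 <= n)%N)
    (Y : set (circle R)) (hY : infinite_set Y) :
  forall eps : R, 0 < eps -> Zk n k Y eps @[k --> \oo] --> (1 : R).
Proof.
move=> eps eps0; have n0 : (0 < n)%N := ltnW hn.
have n1 : `|n%:R^-1 : R| < 1.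
  by rewrite ger0_norm ?invr_ge0 ?ler0n // invf_lt1 ?ltr1n // ltr0n.
(* l fixes the scale eps; m, chosen after it, beats the factor n ^ l. *)
have [l _ /(_ l (leqnn l))/ltr_normlW] := cvgr0_norm_lt _ (cvg_expr n1) _ eps0.
rewrite exprVn => l_eps.
have l1 : 1 <= n%:R ^+ l :> R by rewrite exprn_ege1 // ler1n.
have l0 : 0 < n%:R ^+ l :> R by exact: lt_le_trans l1.
apply/cvgrPdist_le => delta delta0.
have q1 : `|1 - n%:R ^- l : R| < 1.
  by rewrite ger0_norm ?subr_ge0 ?invf_le1 // ltrBlDr ltrDl invr_gt0.
have dl : 0 < delta / n%:R ^+ l by rewrite divr_gt0.
have [m _ /(_ m (leqnn m))/ltr_normlW/ltW] :=
  cvgr0_norm_lt _ (cvg_expr q1) _ dl.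
rewrite ler_pdivlMr // mulrC => m_delta.
near=> k.
have lk : (l <= k)%N by near: k; exact: nbhs_infty_ge.
have [S m_le S_Y] : exists2 S : {set k.-tuple 'I_n}, (m <= #|S|)%N &
    forall w, w \in S -> exists2 y, Y y & word_arc w y.
  by near: k; exact: infinite_set_meets_many_arcs.
rewrite ger0_norm ?subr_ge0 ?Zk_le1 //.
move: S m_le S_Y; rewrite -(subnKC lk) => S m_le S_Y.
have := Zk_ge n0 _ _ _ _ _ _ l_eps m_le S_Y; lra.
Unshelve. all: by end_near.
Qed.
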